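(* Let $n\ge 1$. Applying the local bitwise rule in each position and collecting the local signs gives exactly the multiplication of base vectors of order $n$. That is, let $x=x_1\cdots x_n$ and $y=y_1\cdots y_n$ be words in $\Delta_n=\{1,2,4,7\}^n$, and let $(a_rb_r)$ and $(c_rd_r)$ be the two-bit codes of $x_r$ and $y_r$. Put $$m_r=(b_r\mathbin{\&}c_r)+((a_r\odot b_r)\mathbin{\&}d_r)+(a_r\mathbin{\&}(c_r\odot d_r)),$$ and let $z_r\in\{1,2,4,7\}$ be the digit with two-bit code $(a_r\odot c_r)(b_r\odot d_r)$. Then the product of $x$ and $y$ as base vectors is $$xy=\Bigl(\prod_{r=1}^n(-1)^{m_r+1}\Bigr)\,z_1z_2\cdots z_n.$$
   Context: The digits $1,2,4,7$ are identified with the quaternionic symbols $1\leftrightarrow i$, $2\leftrightarrow j$, $4\leftrightarrow k$, $7\leftrightarrow e$, where $e$ is the identity, $i^2=j^2=k^2=-e$, $ij=k=-ji$, $jk=i=-kj$, $ki=j=-ik$. Their two-bit codes are $1=(00)$, $2=(01)$, $4=(10)$, $7=(11)$. $\odot$ is the XNOR of two bits and $\&$ is the AND of two bits. A base vector of order $n$ is a word of length $n$ in the alphabet $\{1,2,4,7\}$. Multiplication of base vectors of order $n$ is digitwise: if the local quaternionic product is $x_ry_r=\varepsilon_r w_r$ with $\varepsilon_r\in\{\pm1\}$ and $w_r\in\{1,2,4,7\}$, then $xy:=\left(\prod_{r=1}^n\varepsilon_r\right)w_1w_2\cdots w_n$. *)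

(* Defs.v *)
From mathcomp Require Import all_boot all_algebra.
Set Implicit Arguments.
Unset Strict Implicit.
Unset Printing Implicit Defensive.
Import GRing.Theory.
Local Open Scope ring_scope.

(* The digits 1, 2, 4, 7 stand for the quaternionic symbols i, j, k, e. *)
Inductive digit := D1 | D2 | D4 | D7.

Definition code (x : digit) : bool * bool :=
  match x with
  | D1 => (false, false)
  | D2 => (false, true)
  | D4 => (true, false)
  | D7 => (true, true)
  end.

Definition digit_of_code (ab : bool * bool) : digit :=
  match ab with
  | (false, false) => D1
  | (false, true) => D2
  | (true, false) => D4
  | (true, true) => D7
  end.

Lemma codeK : cancel code digit_of_code.
Proof. by case. Qed.

Lemma digit_of_codeK : cancel digit_of_code code.
Proof. by case=> [[] []]. Qed.

Definition xnor (a b : bool) : bool := ~~ (a (+) b).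

(* [quat_mul x y = (eps, w)] means x y = eps w: e is the identity,
   i^2 = j^2 = k^2 = -e, ij = k = -ji, jk = i = -kj, ki = j = -ik. *)
Definition quat_mul (x y : digit) : int * digit :=
  match x, y with
  | D7, w => (1, w)
  | w, D7 => (1, w)
  | D1, D1 => (-1, D7)
  | D2, D2 => (-1, D7)
  | D4, D4 => (-1, D7)
  | D1, D2 => (1, D4)
  | D2, D1 => (-1, D4)
  | D2, D4 => (1, D1)
  | D4, D2 => (-1, D1)
  | D4, D1 => (1, D2)
  | D1, D4 => (-1, D2)
  end.

Definition base_vector (n : nat) := n.-tuple digit.

(* A pair (eps, w), with eps = 1 or -1, is the signed base vector eps w. *)
Definition base_vector_mul (n : nat) (x y : base_vector n) :
    int * base_vector n :=
  (\prod_(r < n) (quat_mul (tnth x r) (tnth y r)).1,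
   [tuple (quat_mul (tnth x r) (tnth y r)).2 | r < n]).

(* Main.v *)
Require Import Defs.
From mathcomp Require Import all_boot all_algebra.
Set Implicit Arguments.
Unset Strict Implicit.
Unset Printing Implicit Defensive.
Import GRing.Theory.
Local Open Scope ring_scope.

(** Both the signed product and the bit formulas act position by position, so everything reduces to
    a single digit: XNOR of the codes gives the digit of the quaternionic product, and its sign is
    positive exactly when the sum of the three AND terms is odd. [quat_mul_code] checks this on the
    sixteen pairs of digits. *)

Lemma quat_mul_code (u v : digit) :
  let: (a, b) := code u in
  let: (c, d) := code v in
  quat_mul u v =
    ((-1) ^+ ((b && c) + (xnor a b && d) + (a && xnor c d) + 1)%N,
     digit_of_code (xnor a c, xnor b d)).
Proof. by case: u; case: v. Qed.

Theorem theorem2p7 (n : nat) (hn : (1 <= n)%N) (x y : base_vector n) :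
  let a (r : 'I_n) : bool := (code (tnth x r)).1 in
  let b (r : 'I_n) : bool := (code (tnth x r)).2 in
  let c (r : 'I_n) : bool := (code (tnth y r)).1 in
  let d (r : 'I_n) : bool := (code (tnth y r)).2 in
  let m (r : 'I_n) : nat :=
    ((b r && c r) + (xnor (a r) (b r) && d r) + (a r && xnor (c r) (d r)))%N in
  let z : base_vector n :=
    [tuple digit_of_code (xnor (a r) (c r), xnor (b r) (d r)) | r < n] in
  base_vector_mul x y = (\prod_(r < n) (-1) ^+ (m r + 1), z).
Proof.
move=> a b c d m z.
have quatE r : quat_mul (tnth x r) (tnth y r) =
    ((-1) ^+ (m r + 1), digit_of_code (xnor (a r) (c r), xnor (b r) (d r))).
  have := quat_mul_code (tnth x r) (tnth y r).
  (* Splitting both codes into explicit pairs lets the [let:] patterns of [quat_mul_code] and the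
     projections in [a], [b], [c], [d] reduce to the same bits. *)
  by rewrite /m /a /b /c /d; case: (code _) => ? ?; case: (code _).
congr pair; first by apply: eq_bigr => r _; rewrite quatE.
by apply: eq_from_tnth => r; rewrite !tnth_mktuple quatE.
Qed.
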